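(* Let $C,C_1,D,D_1$ be at most countable sets, let $u\in\Delta\bigl(K\times(C\times C_1)\times(D\times D_1)\bigr)$ and $v=\mathrm{marg}_{K\times C\times D}u$. Suppose that, under $u$, $d_1$ is $\varepsilon$-conditionally independent from $(k,c)$ given $d$, and $c_1$ is $\varepsilon$-conditionally independent from $(k,d)$ given $c$. Then $$d(u,v)\le\varepsilon.$$
   Context: $K$ is a finite set with $|K|\ge2$. An information structure is a probability on $K\times S_1\times S_2$ with $S_1,S_2$ at most countable, where $k\in K$ is the state and $S_i$ is the set of signals of player $i$. In $u$, player 1's signal is $(c,c_1)\in C\times C_1$ and player 2's signal is $(d,d_1)\in D\times D_1$; in $v$ the signals are $c$ and $d$. $\mathrm{marg}$ denotes the marginal distribution. For a distribution $\mu\in\Delta(X\times Y\times Z)$ over countable spaces, the random variables $x$ and $y$ are $\varepsilon$-conditionally independent given $z$ if $$\sum_z\mu(z)\sum_{x,y}\bigl|\mu(x,y|z)-\mu(x|z)\mu(y|z)\bigr|\le\varepsilon.$$ A payoff function is a map $g:K\times I\times J\to[-1,1]$ with $I,J$ nonempty finite sets; $\mathcal{G}$ is the set of all payoff functions. In the zero-sum Bayesian game $\Gamma(u,g)$, $(k,s_1,s_2)$ is drawn from $u$, player $i$ learns $s_i$, they simultaneously choose $i\in I$ and $j\in J$, and player 1 (the maximizer) receives $g(k,i,j)$ from player 2; $\mathrm{val}(u,g)$ is its value in mixed strategies. The value-based distance is $d(u,v)=\sup_{g\in\mathcal{G}}|\mathrm{val}(u,g)-\mathrm{val}(v,g)|$.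 *)

(* Defs.v *)
From HB Require Import structures.
From mathcomp Require Import all_boot all_order all_algebra.
From mathcomp Require Import boolp classical_sets functions cardinality fsbigop.
From mathcomp Require Import reals ereal topology normedtype sequences numfun esum.

Set Implicit Arguments.
Unset Strict Implicit.
Unset Printing Implicit Defensive.

Import Order.TTheory GRing.Theory Num.Theory.
Local Open Scope classical_set_scope.
Local Open Scope ring_scope.

(* A probability on an at most countable set, given by its mass function. *)
Record prob (R : realType) (T : countType) := Prob {
  mass :> T -> R ;
  mass_ge0 : forall x, 0 <= mass x ;
  mass_sum1 : (\esum_(x in [set: T]) (mass x)%:E = 1)%E }.

Section Expectation.
Context {R : realType} {T : countType}.

(* Absolutely convergent (unordered) sums of reals; only used on families
   dominated by a probability, for which both terms are finite. *)
Definition rsum (f : T -> R) : R :=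
  let F := EFin \o f in
  fine (\esum_(x in [set: T]) F^\+ x - \esum_(x in [set: T]) F^\- x)%E.

Definition expect (mu : prob R T) (f : T -> R) : R :=
  rsum (fun x => mu x * f x).

End Expectation.

Section Pushforward.
Context {R : realType} {T U : countType}.
Variables (f : T -> U) (mu : prob R T).

Definition push_mass (y : U) : R :=
  fine (\esum_(x in f @^-1` [set y]) (mu x)%:E)%E.

Lemma push_massE y :
  (push_mass y)%:E = (\esum_(x in f @^-1` [set y]) (mu x)%:E)%E.
Proof.
rewrite /push_mass fineK// fin_real//; apply/andP; split.
  by rewrite (lt_le_trans (ltNyr 0))// esum_ge0// => x _; rewrite lee_fin mass_ge0.
rewrite (le_lt_trans _ (ltry 1))// -(mass_sum1 mu) esum_mkcond.
apply: le_esum => x _.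
by case: ifP => // _; rewrite lee_fin mass_ge0.
Qed.

Lemma push_mass_ge0 y : 0 <= push_mass y.
Proof. by rewrite fine_ge0// esum_ge0// => x _; rewrite lee_fin mass_ge0. Qed.

Lemma push_mass_sum1 : (\esum_(y in [set: U]) (push_mass y)%:E = 1)%E.
Proof.
under eq_esum do rewrite push_massE.
rewrite (@esum_esum _ _ _ _ _ (fun _ x => (mu x)%:E)); last first.
  by move=> y x; rewrite lee_fin mass_ge0.
rewrite -(mass_sum1 mu).
rewrite (@reindex_esum _ _ _ [set: T] _ (fun x => (f x, x))) //.
- split => [x _|x x' _ _ [_ ->]|[y x] /= [_ <-]] //.
  by exists x.
Qed.

Definition push : prob R U := Prob push_mass_ge0 push_mass_sum1.

End Pushforward.

Section ConditionalIndependence.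
Context {R : realType} {X Y Z : countType}.
Variable mu : prob R (X * Y * Z)%type.

Let muZ := push (fun t : X * Y * Z => t.2) mu.
Let muXZ := push (fun t : X * Y * Z => (t.1.1, t.2)) mu.
Let muYZ := push (fun t : X * Y * Z => (t.1.2, t.2)) mu.

(* When mu(z) = 0 the conditional masses below are 0 by division by zero, and
   they are weighted by mu(z) = 0. *)
Definition eps_cond_indep (eps : R) : Prop :=
  (\esum_(z in [set: Z]) ((muZ z)%:E *
     \esum_(p in [set: X * Y])
       `| mu (p, z) / muZ z
          - (muXZ (p.1, z) / muZ z) * (muYZ (p.2, z) / muZ z) |%:E)
   <= eps%:E)%E.

End ConditionalIndependence.

Notation info_structure R K S1 S2 := (prob R (K * S1 * S2)%type).

Record payoff (R : realType) (K : finType) := Payoff {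
  act1 : finType ;
  act2 : finType ;
  act1_gt0 : (0 < #|act1|)%N ;
  act2_gt0 : (0 < #|act2|)%N ;
  pay :> K -> act1 -> act2 -> R ;
  pay_bounded : forall k i j, -1 <= pay k i j <= 1 }.

Section BayesianGame.
Context {R : realType} {K : finType} {S1 S2 : countType}.
Variables (u : info_structure R K S1 S2) (g : payoff R K).

Definition strategy1 := S1 -> prob R (act1 g).
Definition strategy2 := S2 -> prob R (act2 g).

Definition game_payoff (sigma : strategy1) (tau : strategy2) : R :=
  expect u (fun t : K * S1 * S2 =>
    \sum_(i : act1 g) \sum_(j : act2 g)
      sigma t.1.2 i * tau t.2 j * g t.1.1 i j).

Definition maxmin : R :=
  sup [set inf [set game_payoff sigma tau | tau in [set: strategy2]]
      | sigma in [set: strategy1]].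

Definition minmax : R :=
  inf [set sup [set game_payoff sigma tau | sigma in [set: strategy1]]
      | tau in [set: strategy2]].

Definition is_value (w : R) : Prop := maxmin = w /\ minmax = w.

(* The default 0 is never used: payoffs are bounded by 1 in absolute value and,
   the action sets being finite, a minimax theorem gives maxmin = minmax. *)
Definition value : R := xget 0 [set w | is_value w].

End BayesianGame.

(* The set of which the supremum is taken is nonempty and bounded by 2, all
   values being in [-1, 1]. *)
Definition value_dist (R : realType) (K : finType) (S1 S2 T1 T2 : countType)
    (u : info_structure R K S1 S2) (v : info_structure R K T1 T2) : R :=
  sup [set r : R | exists g : payoff R K, r = `| value u g - value v g |].

(* Main.v *)
Require Import Defs.
From HB Require Import structures.
From mathcomp Require Import all_boot all_order all_algebra.
From mathcomp Require Import boolp classical_sets fsbigop.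
From mathcomp Require Import reals ereal numfun esum.
From mathcomp Require Import ring lra.

Set Implicit Arguments.
Unset Strict Implicit.
Unset Printing Implicit Defensive.

Import Order.TTheory GRing.Theory Num.Theory.
Local Open Scope ring_scope.

(** The comparison rests on one inequality. Suppose player 2 uses a strategy
tau that depends on (d, d1), while player 1 looks only at c. The expected
payoff then depends on the law of (k, c, d, d1) alone, and conditional
independence says that this law is within eps, in total variation norm, of the
law in which d1 is redrawn from its conditional distribution given d. Under the
latter law tau does exactly as well as its average tau' given d, which is a
strategy of the game with the smaller signals. Payoffs being bounded by 1,
replacing tau by tau' changes the payoff by at most eps ([forget_signal]).
Hence a strategy of player 1 that guarantees w with the smaller signals
guarantees w - eps with the larger ones, whence
[maxmin v g - eps <= maxmin u g]. The same argument with the players exchanged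
gives [minmax u g <= minmax v g + eps].

These two bounds concern different quantities, so closing the gap takes the
minimax theorem for games with countably many signals ([minimax]). It is
obtained without compactness or truncation, from a no-regret argument: player 1
runs regret matching separately at each signal, against an opponent who at
every round almost best-replies to the current behaviour strategy. After n
rounds the regret at a signal is of order sqrt(n) times the mass of that signal
([no_regret]); summing over signals, the average of player 2's replies holds
player 1 to maxmin up to a vanishing error. *)

(** * Unordered sums of real families over countable types *)

Section EsumComplements.
Local Open Scope ereal_scope.
Context {R : realType}.

Lemma esumZl (T : choiceType) (c : R) (f : T -> \bar R) :
  (0 <= c)%R -> (forall x, 0 <= f x) ->
  \esum_(x in setT) (c%:E * f x) = c%:E * \esum_(x in setT) f x.
Proof.
move=> c0 f0; rewrite /esum -ereal_supZl//; last first.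
  by apply/set0P; exists (\sum_(x \in set0) f x); exists set0 => //; exact: fsets_set0.
congr ereal_sup; apply/seteqP; split => [_ [X XT <-]|_ [_ [X XT <-] <-]].
  by exists (\sum_(x \in X) f x); [exists X|rewrite ge0_mule_fsumr].
by exists X => //; rewrite ge0_mule_fsumr.
Qed.

(** Carrying a bijection lets one statement cover sums over pairs in either
order and sums over triples grouped in any way. *)
Lemma esum_fubini (A B T : choiceType) (e : A * B -> T) (f : T -> \bar R) :
  bijective e -> (forall x, 0 <= f x) ->
  \esum_(x in setT) f x = \esum_(a in setT) \esum_(b in setT) f (e (a, b)).
Proof.
move=> e_bij f0; rewrite (@esum_esum _ _ _ _ _ (fun a b => f (e (a, b))))//.
apply: (@reindex_esum _ _ _ _ _ (fun k => e (k.1, k.2))).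
have [e' eK e'K] := e_bij; split => //= [[a b] [a' b'] _ _ /=|x _].
  exact: (can_inj eK).
by exists (e' x) => //; rewrite -surjective_pairing e'K.
Qed.

Lemma esum_point (T : choiceType) (y : T) (c : R) : (0 <= c)%R ->
  \esum_(x in setT) ((y == x)%:R * c)%:E = c%:E.
Proof.
move=> c0; rewrite (esumID [set y])//; last first.
  by move=> x _; rewrite lee_fin mulr_ge0.
rewrite setTI esum_set1 ?lee_fin ?mulr_ge0// eqxx mul1r.
rewrite [X in _ + X]esum1 ?adde0// => x [_ /= /eqP].
by rewrite eq_sym => /negPf ->; rewrite mul0r.
Qed.

End EsumComplements.

Section Rsum.
Context {R : realType}.
Implicit Types T : countType.

(** The condition under which both nonnegative sums in the definition of [rsum]
are finite, so that [rsum] is linear. *)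
Definition summ T (f : T -> R) := summable setT (EFin \o f).

Lemma summE T (f : T -> R) :
  summ f = (\esum_(x in setT) `|f x|%:E < +oo)%E :> Prop.
Proof. by []. Qed.

Lemma summ_le T (g f : T -> R) : summ g -> (forall x, `|f x| <= g x) -> summ f.
Proof.
move=> sg fg; apply: le_lt_trans sg; apply: le_esum => x _ /=.
by rewrite lee_fin (le_trans (fg x)) ?ler_norm.
Qed.

Lemma ge0_summ_fin T (f : T -> R) : (forall x, 0 <= f x) -> summ f ->
  (\esum_(x in setT) (f x)%:E \is a fin_num)%E.
Proof.
move=> f0; rewrite /summ summableE.
by under eq_esum => x _ do rewrite /= ger0_norm//.
Qed.

Lemma ge0_rsum T (f : T -> R) : (forall x, 0 <= f x) ->
  rsum f = fine (\esum_(x in setT) (f x)%:E)%E.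
Proof.
move=> f0; rewrite /rsum; congr fine.
rewrite [X in (_ - X)%E]esum1 ?sube0 => [|x _]; last first.
  by rewrite (@ge0_funenegE _ _ setT) ?inE// => y _; rewrite lee_fin.
apply: eq_esum => x _.
by rewrite (@ge0_funeposE _ _ setT) ?inE// => y _; rewrite lee_fin.
Qed.

Lemma ge0_rsumE T (f : T -> R) : (forall x, 0 <= f x) -> summ f ->
  (rsum f)%:E = (\esum_(x in setT) (f x)%:E)%E.
Proof. by move=> f0 sf; rewrite ge0_rsum ?fineK// ge0_summ_fin. Qed.

Lemma eq_rsum T (f g : T -> R) : f =1 g -> rsum f = rsum g.
Proof. by move=> /funext ->. Qed.

(** The value of [rsum] can be read off any decomposition as a difference of
nonnegative summable families, not only the canonical one; linearity is deduced
from this freedom. *)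
Lemma rsumB_ge0 T (p q : T -> R) : (forall x, 0 <= p x) -> (forall x, 0 <= q x) ->
  summ p -> summ q -> rsum (p \- q) = rsum p - rsum q.
Proof.
move=> p0 q0 sp sq; rewrite (ge0_rsum p0) (ge0_rsum q0) -fineB ?ge0_summ_fin//.
by rewrite -(esumB sp sq)// => x _; rewrite lee_fin.
Qed.

Lemma summD T (f g : T -> R) : summ f -> summ g -> summ (f \+ g).
Proof. exact: summableD. Qed.

Lemma summB T (f g : T -> R) : summ f -> summ g -> summ (f \- g).
Proof. exact: summableB. Qed.

Lemma summN T (f : T -> R) : summ f -> summ (\- f).
Proof. by rewrite /summ summableN. Qed.

Lemma summZ T c (f : T -> R) : summ f -> summ (fun x => c * f x).
Proof.
rewrite !summE => sf; under eq_esum do rewrite normrM EFinM.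
by rewrite esumZl// lte_mul_pinfty// lee_fin.
Qed.

Lemma summ_sum T (I : Type) (r : seq I) (f : I -> T -> R) :
  (forall i, summ (f i)) -> summ (fun x => \sum_(i <- r) f i x).
Proof.
move=> sf; elim: r => [|i r IH].
  rewrite summE esum1 ?ltry// => x _; by rewrite big_nil normr0.
under eq_fun do rewrite big_cons.
exact: summD.
Qed.

Lemma ge0_rsumD T (p q : T -> R) : (forall x, 0 <= p x) -> (forall x, 0 <= q x) ->
  summ p -> summ q -> rsum (p \+ q) = rsum p + rsum q.
Proof.
move=> p0 q0 sp sq; apply: EFin_inj; rewrite EFinD !ge0_rsumE//.
- by rewrite -esumD// => x _; rewrite lee_fin.
- by move=> x; rewrite addr_ge0.
- exact: summD.
Qed.

Lemma funrposnegE T (f : T -> R) x : f x = f^\+ x - f^\- x.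
Proof. by rewrite -[in LHS](funrposBneg f). Qed.

Lemma summ_norm T (f : T -> R) : summ f -> summ (fun x => `|f x|).
Proof. by rewrite !summE => sf; under eq_esum do rewrite normr_id. Qed.

Lemma summ_funrpos T (f : T -> R) : summ f -> summ f^\+.
Proof. by move=> sf; rewrite /summ -funerpos; exact: summable_funepos. Qed.

Lemma summ_funrneg T (f : T -> R) : summ f -> summ f^\-.
Proof. by move=> sf; rewrite /summ -funerneg; exact: summable_funeneg. Qed.

Lemma rsum_posneg T (f : T -> R) : summ f ->
  rsum f = rsum (f^\+) - rsum (f^\-).
Proof.
move=> sf; rewrite -rsumB_ge0//; first exact/eq_rsum/funrposnegE.
- exact: summ_funrpos.
- exact: summ_funrneg.
Qed.

Lemma rsumD T (f g : T -> R) : summ f -> summ g -> rsum (f \+ g) = rsum f + rsum g.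
Proof.
move=> sf sg; rewrite (rsum_posneg sf) (rsum_posneg sg).
have -> : f \+ g = (f^\+ \+ g^\+) \- (f^\- \+ g^\-).
  by apply/funext => x; rewrite /= (funrposnegE f) (funrposnegE g); ring.
have [fp fn] := (summ_funrpos sf, summ_funrneg sf).
have [gp gn] := (summ_funrpos sg, summ_funrneg sg).
rewrite rsumB_ge0; last first.
- exact: summD.
- exact: summD.
- by move=> x; rewrite addr_ge0 ?funrneg_ge0.
- by move=> x; rewrite addr_ge0 ?funrpos_ge0.
rewrite (ge0_rsumD (funrpos_ge0 f) (funrpos_ge0 g) fp gp).
rewrite (ge0_rsumD (funrneg_ge0 f) (funrneg_ge0 g) fn gn).
by rewrite opprD addrACA.
Qed.

Lemma rsumN T (f : T -> R) : summ f -> rsum (\- f) = - rsum f.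
Proof.
move=> sf; rewrite (rsum_posneg (summN sf)) (rsum_posneg sf) opprB.
by rewrite funrposN funrnegN.
Qed.

Lemma rsumB T (f g : T -> R) : summ f -> summ g -> rsum (f \- g) = rsum f - rsum g.
Proof. by move=> sf sg; rewrite -rsumN// -rsumD//; exact: summN. Qed.

Lemma rsum_ge0 T (f : T -> R) : (forall x, 0 <= f x) -> 0 <= rsum f.
Proof.
by move=> f0; rewrite ge0_rsum// fine_ge0// esum_ge0// => x _; rewrite lee_fin.
Qed.

Lemma ler_rsum T (f g : T -> R) : summ f -> summ g -> (forall x, f x <= g x) ->
  rsum f <= rsum g.
Proof.
by move=> sf sg fg; rewrite -subr_ge0 -rsumB// rsum_ge0// => x; rewrite subr_ge0.
Qed.

Lemma ge0_rsumZ T c (f : T -> R) : 0 <= c -> (forall x, 0 <= f x) -> summ f ->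
  rsum (fun x => c * f x) = c * rsum f.
Proof.
move=> c0 f0 sf; apply: EFin_inj; rewrite EFinM !ge0_rsumE//.
- by rewrite -esumZl//.
- by move=> x; rewrite mulr_ge0.
- exact: summZ.
Qed.

Lemma rsumZ T c (f : T -> R) : summ f -> rsum (fun x => c * f x) = c * rsum f.
Proof.
move=> sf; have pos d (d0 : 0 <= d) : rsum (fun x => d * f x) = d * rsum f.
  have -> : (fun x => d * f x) =
      (fun x => d * f^\+ x) \- (fun x => d * f^\- x).
    by apply/funext => x; rewrite /= (funrposnegE f) mulrBr.
  have [sp sn] := (summ_funrpos sf, summ_funrneg sf).
  rewrite rsumB_ge0; last first.
  - exact: summZ.
  - exact: summZ.
  - by move=> x; rewrite mulr_ge0 ?funrneg_ge0.
  - by move=> x; rewrite mulr_ge0 ?funrpos_ge0.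
  rewrite (rsum_posneg sf) mulrBr (ge0_rsumZ d0 (funrpos_ge0 f) sp).
  by rewrite (ge0_rsumZ d0 (funrneg_ge0 f) sn).
have [c0|c0] := leP 0 c; first exact: pos.
have -> : (fun x => c * f x) = \- (fun x => (- c) * f x).
  by apply/funext => x /=; rewrite mulNr opprK.
by rewrite rsumN ?pos ?mulNr ?opprK ?oppr_ge0 ?ltW//; apply: summZ.
Qed.

Lemma rsumZr T c (f : T -> R) : summ f -> rsum (fun x => f x * c) = rsum f * c.
Proof. by move=> sf; rewrite mulrC -rsumZ//; apply: eq_rsum => x; rewrite mulrC. Qed.

Lemma rsum_sum T (I : Type) (r : seq I) (f : I -> T -> R) :
  (forall i, summ (f i)) ->
  rsum (fun x => \sum_(i <- r) f i x) = \sum_(i <- r) rsum (f i).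
Proof.
move=> sf; elim: r => [|i r IH].
  rewrite big_nil ge0_rsum => [|x]; last by rewrite big_nil.
  by rewrite esum1// => x _; rewrite big_nil.
rewrite big_cons -IH -rsumD//; last exact: summ_sum.
by apply: eq_rsum => x; rewrite big_cons.
Qed.

Lemma ler_norm_rsum T (g f : T -> R) : summ g -> (forall x, `|f x| <= g x) ->
  `|rsum f| <= rsum g.
Proof.
move=> sg fg; have sf := summ_le sg fg.
rewrite ler_norml -rsumN//; apply/andP; split; apply: ler_rsum => //.
- exact: summN.
- by move=> x; have := fg x; rewrite ler_norml => /andP[].
- by move=> x; have := fg x; rewrite ler_norml => /andP[].
Qed.

Section Fubini.
Variables (A B T : countType) (e : A * B -> T).
Hypothesis e_bij : bijective e.

Lemma summ_section (f : T -> R) a : summ f -> summ (fun b => f (e (a, b))).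
Proof.
move=> sf; rewrite summE; apply: le_lt_trans sf.
rewrite (@esum_fubini _ _ _ _ e (abse \o (EFin \o f)))//.
have i0 x : (0 <= \esum_(b in setT) `|f (e (x, b))|%:E)%E by exact: esum_ge0.
rewrite [leRHS](esumID [set a])/=; last by move=> x _; exact: i0.
rewrite setTI esum_set1; last exact: i0.
by rewrite leeDl ?esum_ge0//.
by move=> x; exact: abse_ge0.
Qed.

Lemma ge0_rsum_fubini (f : T -> R) : (forall x, 0 <= f x) -> summ f ->
  summ (fun a => rsum (fun b => f (e (a, b)))) /\
  rsum f = rsum (fun a => rsum (fun b => f (e (a, b)))).
Proof.
move=> f0 sf; have i0 a : 0 <= rsum (fun b => f (e (a, b))) by exact: rsum_ge0.
have E : (rsum f)%:E = (\esum_(a in setT) (rsum (fun b => f (e (a, b))))%:E)%E.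
  rewrite ge0_rsumE// (@esum_fubini _ _ _ _ e)//.
  apply: eq_esum => a _; rewrite ge0_rsumE//; exact: summ_section.
have si : summ (fun a => rsum (fun b => f (e (a, b)))).
  by rewrite summE; under eq_esum do rewrite ger0_norm//; rewrite -E ltry.
by split=> //; apply: EFin_inj; rewrite E ge0_rsumE.
Qed.

Lemma rsum_fubini (f : T -> R) : summ f ->
  summ (fun a => rsum (fun b => f (e (a, b)))) /\
  rsum f = rsum (fun a => rsum (fun b => f (e (a, b)))).
Proof.
move=> sf; have [sp Ep] := ge0_rsum_fubini (funrpos_ge0 f) (summ_funrpos sf).
have [sn En] := ge0_rsum_fubini (funrneg_ge0 f) (summ_funrneg sf).
have E : (fun a => rsum (fun b => f (e (a, b)))) =
   (fun a => rsum (fun b => f^\+ (e (a, b)))) \-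
   (fun a => rsum (fun b => f^\- (e (a, b)))).
  apply/funext => a; rewrite /= (rsum_posneg (summ_section _ sf)).
  by congr (_ - _).
by rewrite E; split; [exact: summB|rewrite rsumB// -Ep -En; exact: rsum_posneg].
Qed.

End Fubini.

Lemma bij_pair (A B : Type) : bijective (fun p : A * B => (p.1, p.2)).
Proof. by exists id => -[]. Qed.

Lemma bij_swap (A B : Type) : bijective (fun p : A * B => (p.2, p.1)).
Proof. by exists (fun p => (p.2, p.1)) => -[]. Qed.

Section Points.
Variables (U : countType) (y : U).

Let esum_dirac : (\esum_(x in [set: U]) ((y == x)%:R : R)%:E = 1)%E.
Proof. by under eq_esum do rewrite -[_%:R]mulr1; rewrite esum_point. Qed.

Lemma summ_dirac : summ (fun x : U => (y == x)%:R : R).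
Proof.
by rewrite summE; under eq_esum do rewrite normr_nat; rewrite esum_dirac ltry.
Qed.

Lemma rsum_dirac : rsum (fun x : U => (y == x)%:R : R) = 1.
Proof. by rewrite ge0_rsum// esum_dirac. Qed.

Lemma summ_point (c : R) : summ (fun x => (y == x)%:R * c).
Proof. by under eq_fun do rewrite mulrC; exact/summZ/summ_dirac. Qed.

Lemma rsum_point (c : R) : rsum (fun x => (y == x)%:R * c) = c.
Proof. by rewrite (rsumZr _ summ_dirac) rsum_dirac mul1r. Qed.

End Points.

Section FiniteSums.
Variable A : finType.

Let sum_points (f : A -> R) : f = fun x => \sum_a (a == x)%:R * f a.
Proof.
apply/funext => x; rewrite (bigD1 x)//= eqxx mul1r big1 ?addr0// => a /negPf ->.
by rewrite mul0r.
Qed.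

Lemma summ_fin (f : A -> R) : summ f.
Proof. by rewrite [f]sum_points; apply: summ_sum => a; exact: summ_point. Qed.

Lemma rsum_fin (f : A -> R) : rsum f = \sum_a f a.
Proof.
rewrite {1}[f]sum_points rsum_sum => [|a]; last exact: summ_point.
by apply: eq_bigr => a _; exact: rsum_point.
Qed.

End FiniteSums.

Section Fibers.
Variables (T U : countType) (phi : T -> U).

Lemma summ_mkfiber (f : T -> R) y : summ f -> summ (fun x => (phi x == y)%:R * f x).
Proof.
move=> sf; apply: (summ_le (summ_norm sf)) => x.
by rewrite normrM normr_nat; case: eqP => _; rewrite ?mul1r ?mul0r.
Qed.

(** Fubini on [T * U] for the family supported by the graph of [phi]: summing
over [U] first leaves a single term, summing over [T] first groups the terms
along the fibers. *)
Lemma rsum_fiber (f : T -> R) : summ f ->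
  summ (fun y => rsum (fun x => (phi x == y)%:R * f x)) /\
  rsum f = rsum (fun y => rsum (fun x => (phi x == y)%:R * f x)).
Proof.
move=> sf; pose h (p : T * U) := (phi p.1 == p.2)%:R * f p.1.
have sh : summ h.
  rewrite summE (@esum_fubini _ _ _ _ _ _ (bij_pair T U))//=.
  rewrite (eq_esum (b := fun x => `|f x|%:E))// => x _.
  rewrite -(esum_point (phi x) (normr_ge0 (f x))).
  by apply: eq_esum => y _; rewrite normrM normr_nat.
have [shU EU] := rsum_fubini (bij_swap U T) sh.
have [_ ET] := rsum_fubini (bij_pair T U) sh.
split=> //; rewrite -[RHS]EU ET; apply: eq_rsum => x.
by rewrite /h /= rsum_point.
Qed.

End Fibers.

End Rsum.

(** * Probabilities *)

Section Prob.
Context {R : realType}.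

Lemma summ_mass (T : countType) (mu : prob R T) : summ mu.
Proof.
rewrite summE; under eq_esum do rewrite ger0_norm ?mass_ge0//.
by rewrite mass_sum1 ltry.
Qed.

Lemma rsum_mass (T : countType) (mu : prob R T) : rsum mu = 1.
Proof. by rewrite ge0_rsum ?mass_sum1//; exact: mass_ge0. Qed.

Lemma summ_expect (T : countType) (mu : prob R T) (c : R) (f : T -> R) :
  (forall x, `|f x| <= c) -> summ (fun x => mu x * f x).
Proof.
move=> fc; apply: (summ_le (summZ c (summ_mass mu))) => x.
by rewrite normrM ger0_norm ?mass_ge0// mulrC ler_wpM2r ?mass_ge0.
Qed.

Lemma expect_norm (T : countType) (mu : prob R T) (c : R) (f : T -> R) :
  (forall x, `|f x| <= c) -> `|expect mu f| <= c.
Proof.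
move=> fc; rewrite -[leRHS]mulr1 -(rsum_mass mu) -rsumZ; last exact: summ_mass.
apply: ler_norm_rsum => [|x]; first exact/summZ/summ_mass.
by rewrite normrM ger0_norm ?mass_ge0// mulrC ler_wpM2r ?mass_ge0.
Qed.

Lemma pushE (T U : countType) (phi : T -> U) (mu : prob R T) y :
  push phi mu y = rsum (fun x => (phi x == y)%:R * mu x).
Proof.
rewrite ge0_rsum => [|x]; last by rewrite mulr_ge0 ?mass_ge0.
rewrite /= /push_mass esum_mkcond; congr fine; apply: eq_esum => x _.
case: eqP => [xy|xy]; first by rewrite mem_set// mul1r.
by rewrite memNset// mul0r.
Qed.

(** Fixes the scale on which payoffs and regrets at a signal are measured: the
probability of that signal. *)
Lemma push_dominates (T U : countType) (phi : T -> U) (mu : prob R T) (f : T -> R)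
  y : (forall x, `|f x| <= 1) ->
  `|rsum (fun x => (phi x == y)%:R * (mu x * f x))| <= push phi mu y.
Proof.
move=> f1; rewrite pushE; apply: ler_norm_rsum => [|x].
  exact/summ_mkfiber/summ_mass.
rewrite !normrM normr_nat ler_wpM2l// ger0_norm ?mass_ge0//.
by rewrite ler_piMr ?mass_ge0.
Qed.

Lemma expect_push (T U : countType) (phi : T -> U) (mu : prob R T) c (f : U -> R) :
  (forall y, `|f y| <= c) -> expect (push phi mu) f = expect mu (f \o phi).
Proof.
move=> fc; have sf : summ (fun x => mu x * f (phi x)) by exact: (@summ_expect _ _ c).
rewrite /expect (rsum_fiber phi sf).2; apply: eq_rsum => y.
rewrite pushE -rsumZr; last exact/summ_mkfiber/summ_mass.
by apply: eq_rsum => x; case: eqP => [->|_]; rewrite ?mul1r// !mul0r.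
Qed.

Section Finite.
Variable A : finType.

Lemma sum_mass (p : prob R A) : \sum_a p a = 1.
Proof. by rewrite -rsum_fin rsum_mass. Qed.

Lemma fin_prob (f : A -> R) : (forall a, 0 <= f a) -> \sum_a f a = 1 ->
  {p : prob R A | p =1 f}.
Proof.
move=> f0 f1; suff E : (\esum_(x in [set: A]) (f x)%:E = 1)%E by exists (Prob f0 E).
by rewrite -ge0_rsumE ?rsum_fin ?f1//; exact: summ_fin.
Qed.

Lemma dirac_prob (a0 : A) : prob R A.
Proof.
have [//||p _] := @fin_prob (fun a => (a == a0)%:R); last exact: p.
by rewrite (bigD1 a0)//= eqxx big1 ?addr0// => a /negPf ->.
Qed.

Lemma mean_norm (p : prob R A) (c : R) (f : A -> R) :
  (forall a, `|f a| <= c) -> `|\sum_a p a * f a| <= c.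
Proof. by move=> fc; rewrite -rsum_fin; exact: expect_norm. Qed.

End Finite.
End Prob.

(** * Regret matching *)

Section Regret.
Context {R : realType} {A : finType}.

(** Playing each action with probability proportional to its positive regret
makes the vector of instantaneous regrets orthogonal to the positive part of the
cumulative regrets, whatever the payoffs x turn out to be. *)
Lemma regret_matching (a0 : A) (r : A -> R) : {q : prob R A |
  forall x : A -> R,
  \sum_a Num.max (r a) 0 * (x a - \sum_b q b * x b) = 0}.
Proof.
pose m a := Num.max (r a) 0; have m0 a : 0 <= m a by rewrite /m le_max lexx orbT.
have [S0|S0] := eqVneq (\sum_a m a) 0.
  (* no positive regret: any play will do *)
  exists (dirac_prob a0) => x; rewrite big1// => a _.
  have /eqP := S0; rewrite psumr_eq0// => /allP/(_ a).
  by rewrite mem_index_enum => /(_ isT)/eqP; rewrite /m => ->; rewrite mul0r.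
have [||q qE] := @fin_prob R A (fun a => m a / \sum_b m b).
- by move=> a; rewrite divr_ge0// sumr_ge0.
- by rewrite -mulr_suml divff.
exists q => x; rewrite -/m.
under eq_bigr do rewrite mulrBr.
rewrite sumrB -mulr_suml mulr_sumr; apply/eqP; rewrite subr_eq0; apply/eqP.
by apply: eq_bigr => a _; rewrite qE mulrA [_ * (_ / _)]mulrC divfK.
Qed.

(** The cross term is the one that regret matching cancels after summation over
actions. *)
Lemma pos_sqrD (r e : R) :
  Num.max (r + e) 0 ^+ 2 <= Num.max r 0 ^+ 2 + Num.max r 0 * e *+ 2 + e ^+ 2.
Proof.
by rewrite !maxEle mulr2n; case: ifPn => re; case: ifPn => r0; rewrite ?expr0n /=; nra.
Qed.

(** The potential is the sum over actions of the squares of the positive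
cumulative regrets. By orthogonality it increases at each round by at most
#|A| (2 w s)^2, so after n rounds the regret is at most 2 w s sqrt(n #|A|), and
this is below n delta (w s) for large n. The environment may react to the whole
current profile q, all signals included; the number of rounds does not depend
on the signal s. *)
Lemma no_regret (a0 : A) (S : Type) (w : S -> R)
    (env : (S -> prob R A) -> S -> A -> R)
    (env_le : forall q s a, `|env q s a| <= w s) (delta : R) : 0 < delta ->
  exists (n : nat) (q : nat -> S -> prob R A), (0 < n)%N /\
  forall s a, \sum_(t < n) env (q t) s a <=
    \sum_(t < n) \sum_b q t s b * env (q t) s b + n%:R * (delta * w s).
Proof.
move=> d0.
pose rm (reg : S -> A -> R) s : prob R A := sval (regret_matching a0 (reg s)).
pose gap q s a := env q s a - \sum_b q s b * env q s b.
pose reg := fix reg n := if n is n'.+1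
  then fun s a => reg n' s a + gap (rm (reg n')) s a else fun _ _ => 0 : R.
pose q t := rm (reg t).
have regE n s a : reg n s a = \sum_(t < n) gap (q t) s a.
  by elim: n => [|n IH]; rewrite ?big_ord0// big_ord_recr /= -IH.
have gap_le p s a : `|gap p s a| <= 2 * w s.
  rewrite mulr2n mulrDl mul1r (le_trans (ler_normB _ _))// lerD//.
  exact: mean_norm.
have w0 s : 0 <= w s by exact: le_trans (env_le (fun=> dirac_prob a0) s a0).
have potential n s :
    \sum_a Num.max (reg n s a) 0 ^+ 2 <= n%:R * (#|A|%:R * (2 * w s) ^+ 2).
  elim: n => [|n IH].
    by rewrite mul0r big1// => a _; rewrite /= maxxx expr0n.
  apply: (@le_trans _ _ (\sum_a (Num.max (reg n s a) 0 ^+ 2 +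
      Num.max (reg n s a) 0 * gap (q n) s a *+ 2 + gap (q n) s a ^+ 2))).
    by apply: ler_sum => a _; exact: pos_sqrD.
  rewrite 2!big_split /= sumrMnl /gap (svalP (regret_matching a0 (reg n s))).
  rewrite mul0rn addr0 -natr1 mulrDl mul1r lerD// -sum1_card natr_sum mulr_suml.
  apply: ler_sum => a _; rewrite mul1r -real_normK ?num_real//.
  by rewrite lerXn2r ?nnegrE ?mulr_ge0//; exact: gap_le.
(* from this number of rounds on, 4 n #|A| <= (n delta)^2 *)
pose N : R := 4 * #|A|%:R / delta ^+ 2.
have N0 : 0 <= N by rewrite divr_ge0 ?sqr_ge0// mulr_ge0 ?ler0n.
have [n n_gt] : exists n : nat, N < n%:R.
  by exists (Num.bound N); exact: archi_boundP.
have n0 : (0 < n)%N by rewrite -(ltr0n R) (le_lt_trans N0).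
exists n, q; split=> // s a; rewrite addrC -lerBlDr -sumrB -[leLHS]regE.
apply: (@le_trans _ _ (Num.max (reg n s a) 0)); first by rewrite le_max lexx.
rewrite -(@ler_pXn2r _ 2)// ?nnegrE ?le_max ?lexx ?orbT//; last first.
  by rewrite !mulr_ge0// ltW.
apply: (@le_trans _ _ (\sum_a Num.max (reg n s a) 0 ^+ 2)).
  by rewrite (bigD1 a)//= lerDl sumr_ge0// => b _; rewrite exprn_even_ge0.
apply: (le_trans (potential n s)).
rewrite /N ltr_pdivrMr ?exprn_gt0// in n_gt.
have {n_gt} := ltW n_gt => /(ler_wpM2l (ler0n R n)).
move=> /(ler_wpM2r (sqr_ge0 (w s))).
by congr (_ <= _); ring.
Qed.

End Regret.

(** * The minimax theorem for Bayesian games *)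

Section Game.
Context {R : realType} {K : finType} {S1 S2 : countType}.
Variables (u : info_structure R K S1 S2) (g : payoff R K).
Implicit Types (sigma : @strategy1 R K S1 g) (tau : @strategy2 R K S2 g).

Lemma action1 : act1 g.
Proof. by have /card_gt0P/sigW[a _] := act1_gt0 g. Qed.

Lemma action2 : act2 g.
Proof. by have /card_gt0P/sigW[a _] := act2_gt0 g. Qed.

Let a1 := action1.
Let a2 := action2.

Lemma pay_norm k i j : `|g k i j| <= 1.
Proof. by rewrite ler_norml pay_bounded. Qed.

Definition reply tau (t : K * S1 * S2) (i : act1 g) : R :=
  \sum_j tau t.2 j * g t.1.1 i j.

Lemma reply_norm tau t i : `|reply tau t i| <= 1.
Proof. by apply: mean_norm => j; exact: pay_norm. Qed.

(** Unnormalised conditional payoff: the factor u(s) is kept, which avoids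
dividing by the mass of signals that may have probability zero. *)
Definition signal_pay tau (s : S1) (i : act1 g) : R :=
  rsum (fun t => (t.1.2 == s)%:R * (u t * reply tau t i)).

Definition signal_mass : prob R S1 := push (fun t : K * S1 * S2 => t.1.2) u.

Lemma signal_pay_norm tau s i : `|signal_pay tau s i| <= signal_mass s.
Proof. by apply: push_dominates => t; exact: reply_norm. Qed.

Lemma summ_signal (f : S1 -> R) c : (forall s, `|f s| <= c * signal_mass s) -> summ f.
Proof. exact: (summ_le (summZ c (summ_mass signal_mass))). Qed.

Lemma summ_reply tau i : summ (fun t => u t * reply tau t i).
Proof. by apply: (@summ_expect _ _ _ 1) => t; exact: reply_norm. Qed.

Lemma mean_payE sigma tau (t : K * S1 * S2) :
  \sum_i \sum_j sigma t.1.2 i * tau t.2 j * g t.1.1 i j =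
  \sum_i sigma t.1.2 i * reply tau t i.
Proof.
by apply: eq_bigr => i _; rewrite mulr_sumr; apply: eq_bigr => j _; rewrite mulrA.
Qed.

Lemma mean_pay_norm sigma tau (t : K * S1 * S2) :
  `|\sum_i \sum_j sigma t.1.2 i * tau t.2 j * g t.1.1 i j| <= 1.
Proof. by rewrite mean_payE; apply: mean_norm => i; exact: reply_norm. Qed.

(** Against a fixed tau, player 1 faces a separate linear problem at each of his
signals; this is what allows regret to be minimised signal by signal. *)
Lemma game_payoff_signal sigma tau :
  game_payoff u sigma tau = rsum (fun s => \sum_i sigma s i * signal_pay tau s i).
Proof.
rewrite /game_payoff /expect.
rewrite (rsum_fiber (fun t : K * S1 * S2 => t.1.2) _).2; last first.
  by apply: (@summ_expect _ _ _ 1) => t; exact: mean_pay_norm.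
apply: eq_rsum => s; rewrite /signal_pay.
have sf i := summ_mkfiber (fun t : K * S1 * S2 => t.1.2) s (summ_reply tau i).
under [RHS]eq_bigr => i _ do rewrite -(rsumZ _ (sf i)).
rewrite -rsum_sum => [|i]; last exact/summZ/sf.
apply: eq_rsum => t; rewrite mean_payE; case: eqP => [<-|_].
  by rewrite mul1r mulr_sumr; apply: eq_bigr => i _; rewrite mul1r mulrCA.
by rewrite mul0r big1// => i _; rewrite mul0r mulr0.
Qed.

Lemma game_payoff_bound sigma tau : -1 <= game_payoff u sigma tau <= 1.
Proof. by rewrite -ler_norml; apply: expect_norm => t; exact: mean_pay_norm. Qed.

Definition floor1 sigma := inf [set game_payoff u sigma tau | tau in setT]%classic.
Definition ceil2 tau := sup [set game_payoff u sigma tau | sigma in setT]%classic.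

Lemma floor1_le sigma tau : floor1 sigma <= game_payoff u sigma tau.
Proof.
apply: ge_inf; last by exists tau.
by exists (-1) => _ [t _ <-]; have /andP[] := game_payoff_bound sigma t.
Qed.

Lemma ceil2_ge sigma tau : game_payoff u sigma tau <= ceil2 tau.
Proof.
apply: ub_le_sup; last by exists sigma.
by exists 1 => _ [s _ <-]; have /andP[] := game_payoff_bound s tau.
Qed.

Lemma floor1_le_maxmin sigma : floor1 sigma <= maxmin u g.
Proof.
apply: ub_le_sup; last by exists sigma.
exists 1 => _ [s _ <-]; apply: le_trans (floor1_le s (fun=> dirac_prob a2)) _.
by have /andP[] := game_payoff_bound s (fun=> dirac_prob a2).
Qed.

Lemma minmax_le_ceil2 tau : minmax u g <= ceil2 tau.
Proof.
apply: ge_inf; last by exists tau.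
exists (-1) => _ [t _ <-]; apply: le_trans (ceil2_ge (fun=> dirac_prob a1) t).
by have /andP[] := game_payoff_bound (fun=> dirac_prob a1) t.
Qed.

Lemma near_optimal1 (delta : R) : 0 < delta ->
  exists sigma, forall tau, maxmin u g - delta <= game_payoff u sigma tau.
Proof.
move=> d0; have : maxmin u g - delta < maxmin u g by rewrite gtrBl.
case/sup_gt => [|_ [sigma _ <-] /ltW h].
  by exists (floor1 (fun=> dirac_prob a1)); exists (fun=> dirac_prob a1).
by exists sigma => tau; exact: le_trans h (floor1_le sigma tau).
Qed.

Lemma near_optimal2 (delta : R) : 0 < delta ->
  exists tau, forall sigma, game_payoff u sigma tau <= minmax u g + delta.
Proof.
move=> d0; have : minmax u g < minmax u g + delta by rewrite ltrDl.
case/inf_lt => [|_ [tau _ <-] /ltW h].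
  by exists (ceil2 (fun=> dirac_prob a2)); exists (fun=> dirac_prob a2).
by exists tau => sigma; exact: le_trans (ceil2_ge sigma tau) h.
Qed.

Lemma maxmin_reply sigma (delta : R) : 0 < delta ->
  exists tau, game_payoff u sigma tau < maxmin u g + delta.
Proof.
move=> d0; have : floor1 sigma < maxmin u g + delta.
  by rewrite (le_lt_trans (floor1_le_maxmin sigma))// ltrDl.
case/inf_lt => [|_ [tau _ <-] h]; last by exists tau.
by exists (game_payoff u sigma (fun=> dirac_prob a2)); exists (fun=> dirac_prob a2).
Qed.

Lemma minmax_reply tau (delta : R) : 0 < delta ->
  exists sigma, minmax u g - delta < game_payoff u sigma tau.
Proof.
move=> d0; have : minmax u g - delta < ceil2 tau.
  by rewrite ltrBlDr (le_lt_trans (minmax_le_ceil2 tau))// ltrDl.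
case/sup_gt => [|_ [sigma _ <-] h]; last by exists sigma.
by exists (game_payoff u (fun=> dirac_prob a1) tau); exists (fun=> dirac_prob a1).
Qed.

Lemma maxmin_ge sigma c : (forall tau, c <= game_payoff u sigma tau) ->
  c <= maxmin u g.
Proof.
move=> sc; apply/ler_addgt0Pr => d d0.
by have [tau /ltW] := maxmin_reply sigma d0; exact/le_trans/sc.
Qed.

Lemma minmax_le tau c : (forall sigma, game_payoff u sigma tau <= c) ->
  minmax u g <= c.
Proof.
move=> tc; apply/ler_addgt0Pr => d d0; rewrite -lerBlDr.
by have [sigma /ltW/le_trans] := minmax_reply tau d0; apply; exact: tc.
Qed.

Lemma maxmin_le_minmax : maxmin u g <= minmax u g.
Proof.
apply: ge_sup => [|_ [sigma _ <-]].
  by exists (floor1 (fun=> dirac_prob a1)); exists (fun=> dirac_prob a1).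
apply: lb_le_inf => [|_ [tau _ <-]].
  by exists (ceil2 (fun=> dirac_prob a2)); exists (fun=> dirac_prob a2).
exact: le_trans (floor1_le sigma tau) (ceil2_ge sigma tau).
Qed.

(** Mixing player 2's strategies signal by signal mixes payoffs, because each
payoff is linear in the behaviour strategy. *)
Lemma avg_strategy2 (n : nat) (tau : nat -> strategy2 g) : (0 < n)%N ->
  exists taubar : strategy2 g, forall s i,
  n%:R * signal_pay taubar s i = \sum_(t < n) signal_pay (tau t) s i.
Proof.
move=> n0; have n0' : n%:R != 0 :> R by rewrite pnatr_eq0 -lt0n.
have avg s2 : {p : prob R (act2 g) |
    p =1 fun j => n%:R^-1 * \sum_(t < n) tau t s2 j}.
  apply: fin_prob => [j|].
    by rewrite mulr_ge0 ?invr_ge0// sumr_ge0// => t _; exact: mass_ge0.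
  rewrite -mulr_sumr exchange_big /=.
  under eq_bigr do rewrite sum_mass.
  by rewrite sumr_const card_ord mulVf.
pose taubar s2 := sval (avg s2); exists taubar => s i.
have avgE t : reply taubar t i = n%:R^-1 * \sum_(l < n) reply (tau l) t i.
  rewrite /reply exchange_big mulr_sumr; apply: eq_bigr => j _.
  by rewrite /taubar (svalP (avg t.2)) -mulrA -mulr_suml.
rewrite /signal_pay -rsum_sum => [|l]; last exact/summ_mkfiber/summ_reply.
rewrite -rsumZ; last exact/summ_mkfiber/summ_reply.
apply: eq_rsum => t; rewrite avgE -!mulr_sumr.
by rewrite mulrCA; congr (_ * _); rewrite mulrCA mulVKf.
Qed.

(** Over n rounds with sigma_t chosen by regret matching and tau_t almost a best
reply to sigma_t, any fixed strategy of player 1 earns at most the regret bound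
more than the sum of the payoffs of (sigma_t, tau_t), each of which is below
maxmin + d/2. So the average of the tau_t holds player 1 to maxmin + d. *)
Lemma minmax_le_maxmin : minmax u g <= maxmin u g.
Proof.
apply/ler_addgt0Pr => d d0; have d2 : 0 < d / 2 by rewrite divr_gt0.
have [br brP] := choice (fun sigma => maxmin_reply sigma d2).
have [n [sigma [n0 reg]]] := no_regret a1 (fun q s i => signal_pay_norm (br q) s i) d2.
have [taubar avg] := avg_strategy2 (fun t => br (sigma t)) n0.
apply: (@minmax_le taubar) => sig.
have n0' : 0 < n%:R :> R by rewrite ltr0n.
rewrite -(ler_pM2l n0').
have sgn (p : S1 -> prob R (act1 g)) tau :
    summ (fun s => \sum_i p s i * signal_pay tau s i).
  apply: (@summ_signal _ 1) => s; rewrite mul1r.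
  by apply: mean_norm => i; exact: signal_pay_norm.
rewrite game_payoff_signal -rsumZ//.
apply: (@le_trans _ _ (rsum (fun s => \sum_(t < n)
   \sum_i sigma t s i * signal_pay (br (sigma t)) s i +
   n%:R * (d / 2) * signal_mass s))).
  apply: ler_rsum => [||s].
  - exact: summZ.
  - by apply: summD; [exact: summ_sum|exact/summZ/summ_mass].
  (* the regret bound holds for each action, hence for their mixture sig s *)
  set rhs := (X in _ <= X).
  have -> : rhs = \sum_i sig s i * rhs by rewrite -mulr_suml sum_mass mul1r.
  rewrite mulr_sumr {}/rhs.
  apply: ler_sum => i _; rewrite mulrCA avg ler_wpM2l ?mass_ge0//.
  by rewrite -mulrA; exact: reg.
rewrite rsumD; [|exact: summ_sum|exact/summZ/summ_mass].
rewrite rsum_sum// rsumZ; last exact: summ_mass.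
rewrite rsum_mass mulr1.
apply: (@le_trans _ _ (\sum_(t < n) (maxmin u g + d / 2) + n%:R * (d / 2))).
  by rewrite lerD2r; apply: ler_sum => t _; rewrite -game_payoff_signal ltW.
by rewrite sumr_const card_ord -[_ *+ n]mulr_natl -mulrDr -addrA -splitr.
Qed.

Lemma minimax : minmax u g = maxmin u g.
Proof. by apply/le_anti; rewrite minmax_le_maxmin maxmin_le_minmax. Qed.

(** By the minimax theorem the default of [value] is never selected. *)
Lemma value_maxmin : value u g = maxmin u g.
Proof.
suff [] : is_value u g (value u g) by [].
by apply: xgetPex; exists (maxmin u g); split; rewrite ?minimax.
Qed.

End Game.

(** * Forgetting a conditionally independent signal *)

Section Marginals.
Context {R : realType} {X Y Z : countType}.
Variable mu : prob R (X * Y * Z)%type.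

Let mZ := push (fun t : X * Y * Z => t.2) mu.
Let mXZ := push (fun t : X * Y * Z => (t.1.1, t.2)) mu.
Let mYZ := push (fun t : X * Y * Z => (t.1.2, t.2)) mu.

Lemma mass_le_push (T U : countType) (nu : prob R T) (phi : T -> U) x :
  nu x <= push phi nu (phi x).
Proof.
rewrite pushE -[leLHS](rsum_point x).
apply: ler_rsum => [||y].
- exact: summ_point.
- exact/summ_mkfiber/summ_mass.
- by case: (x =P y) => [->|_]; rewrite ?eqxx// mul0r mulr_ge0 ?mass_ge0.
Qed.

Lemma push_le_comp (T U V : countType) (nu : prob R T) (phi : T -> U) (psi : U -> V) y :
  push phi nu y <= push (psi \o phi) nu (psi y).
Proof.
rewrite !pushE; apply: ler_rsum => [||x]; do ?exact/summ_mkfiber/summ_mass.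
by rewrite ler_wpM2r ?mass_ge0//=; case: eqP => [->|_]; rewrite ?eqxx.
Qed.

(** The law obtained from mu by redrawing x from its conditional distribution
given z, independently of y. *)
Definition indep_mass (t : X * Y * Z) : R :=
  mYZ (t.1.2, t.2) * (mXZ (t.1.1, t.2) / mZ t.2).

Lemma cond_mass (z : Z) : summ (fun x => mXZ (x, z)) /\
  rsum (fun x => mXZ (x, z)) = mZ z.
Proof.
have sf := summ_mkfiber (fun t : X * Y * Z => t.2) z (summ_mass mu).
have := rsum_fiber (fun t : X * Y * Z => t.1.1) sf.
rewrite (_ : (fun y => rsum _) = fun x => mXZ (x, z)); last first.
  apply/funext => x; rewrite /mXZ pushE; apply: eq_rsum => t.
  by rewrite mulrA -natrM mulnb.
by move=> [sx E]; split=> //; rewrite -E /mZ pushE.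
Qed.

Lemma mYZ_eq0 y z : mZ z = 0 -> mYZ (y, z) = 0.
Proof.
move=> z0; apply/le_anti; rewrite mass_ge0 -z0 andbT.
exact: (push_le_comp mu (fun t => (t.1.2, t.2)) snd (y, z)).
Qed.

(** Multiplying by mu(z) clears the denominators: the eps of conditional
independence is exactly the distance between mu and [indep_mass]. Where
mu(z) = 0 both masses vanish. *)
Lemma eps_cond_indepP (eps : R) : eps_cond_indep mu eps ->
  summ (mu \- indep_mass) /\ rsum (fun t => `|mu t - indep_mass t|) <= eps.
Proof.
rewrite /eps_cond_indep => H.
have E : (\esum_(t in [set: X * Y * Z]) `|mu t - indep_mass t|%:E <= eps%:E)%E.
  apply: le_trans H; rewrite (esum_fubini (bij_swap Z (X * Y)))//.
  apply: le_esum => z _; rewrite -esumZl ?mass_ge0//.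
  apply: le_esum => p _; rewrite -EFinM lee_fin -/mZ -/mXZ -/mYZ.
  rewrite -{1}[mZ z]ger0_norm ?mass_ge0// -normrM.
  have -> : indep_mass (p, z) = mYZ (p.2, z) * (mXZ (p.1, z) / mZ z) by [].
  have [z0|z0] := eqVneq (mZ z) 0.
    rewrite z0 mul0r normr0 mYZ_eq0// mul0r subr0 normr_le0 eq_le mass_ge0 andbT.
    by rewrite -z0; exact: (mass_le_push mu (fun t => t.2) (p, z)).
  by rewrite le_eqVlt; apply/orP; left; apply/eqP; congr (`| _ |); field.
have s : summ (mu \- indep_mass) by rewrite summE (le_lt_trans E) ?ltry.
by split=> //; rewrite -lee_fin ge0_rsumE//; exact: summ_norm s.
Qed.

Lemma summ_cond (A : finType) (tau : Z * X -> prob R A) z a :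
  summ (fun x => mXZ (x, z) * tau (z, x) a).
Proof.
apply: (summ_le (cond_mass z).1) => x.
rewrite ger0_norm ?mulr_ge0 ?mass_ge0// ler_piMr ?mass_ge0//.
by rewrite -(sum_mass (tau (z, x))) (bigD1 a)//= lerDl sumr_ge0// => b _; exact: mass_ge0.
Qed.

(** The conditional expectation of the mixed action tau(z, x) given z. The action
a0 only serves at those z that have probability zero, where both sides
vanish. *)
Lemma cond_avg (A : finType) (a0 : A) (tau : Z * X -> prob R A) :
  exists tau' : Z -> prob R A, forall z a, mZ z * tau' z a =
    rsum (fun x => mXZ (x, z) * tau (z, x) a).
Proof.
pose M z a := rsum (fun x => mXZ (x, z) * tau (z, x) a).
have M0 z a : 0 <= M z a by apply: rsum_ge0 => x; rewrite mulr_ge0 ?mass_ge0.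
have sumM z : \sum_a M z a = mZ z.
  rewrite -(cond_mass z).2 -rsum_sum => [|a]; last exact: summ_cond.
  by apply: eq_rsum => x; rewrite -mulr_sumr sum_mass mulr1.
suff tau'P z : {p : prob R A | forall a, mZ z * p a = M z a}.
  by exists (fun z => sval (tau'P z)) => z a; rewrite (svalP (tau'P z)).
have [z0|z0] := eqVneq (mZ z) 0.
  exists (dirac_prob a0) => a; rewrite z0 mul0r; apply/esym/eqP.
  have /eqP := sumM z; rewrite z0 psumr_eq0// => /allP/(_ a).
  by rewrite mem_index_enum => /(_ isT).
have [||p pE] := @fin_prob R A (fun a => M z a / mZ z).
- by move=> a; rewrite divr_ge0 ?mass_ge0.
- by rewrite -mulr_suml sumM divff.
by exists p => a; rewrite pE mulrC divfK.
Qed.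

(** Under [indep_mass], tau and its conditional average tau' yield the same
payoff against any f that ignores x; passing from mu to [indep_mass] costs at
most eps as the integrand is bounded by 1. Since tau' is built from tau alone,
the estimate is uniform in the opponent's behaviour, which enters through f. *)
Lemma forget_signal (eps : R) (A : finType) (a0 : A) (tau : Z * X -> prob R A) :
  eps_cond_indep mu eps ->
  exists tau' : Z -> prob R A, forall f : Y * Z -> A -> R,
  (forall p a, `|f p a| <= 1) ->
  `|expect mu (fun t => \sum_a tau (t.2, t.1.1) a * f (t.1.2, t.2) a) -
    expect mu (fun t => \sum_a tau' t.2 a * f (t.1.2, t.2) a)| <= eps.
Proof.
move=> /eps_cond_indepP[sd Hd].
have [tau' tau'E] := cond_avg a0 tau; exists tau' => f f1.
pose F t := \sum_a tau (t.2, t.1.1) a * f (t.1.2, t.2) a.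
pose F' p := \sum_a tau' p.2 a * f p a.
have F1 t : `|F t| <= 1 by exact: mean_norm.
have F'1 p : `|F' p| <= 1 by exact: mean_norm.
have sF : summ (fun t => mu t * F t) by exact: (summ_expect mu F1).
have sdF : summ (fun t => (mu t - indep_mass t) * F t).
  by apply: (summ_le (summ_norm sd)) => t; rewrite normrM ler_piMr.
have siF : summ (fun t => indep_mass t * F t).
  rewrite (_ : (fun t => indep_mass t * F t) =
    (fun t => mu t * F t) \- (fun t => (mu t - indep_mass t) * F t)).
    exact: summB.
  by apply/funext => t /=; ring.
have -> : expect mu (fun t => \sum_a tau' t.2 a * f (t.1.2, t.2) a) =
    rsum (fun t => indep_mass t * F t).
  rewrite -[LHS](expect_push (fun t : X * Y * Z => (t.1.2, t.2)) mu F'1).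
  pose e (q : Y * Z * X) := (q.2, q.1.1, q.1.2).
  have e_bij : bijective e.
    by exists (fun t : X * Y * Z => (t.1.2, t.2, t.1.1)) => -[[? ?] ?].
  rewrite (rsum_fubini e_bij siF).2 /expect; apply: eq_rsum => -[y z].
  pose c a := mYZ (y, z) / mZ z * f (y, z) a.
  transitivity (rsum (fun x => \sum_a c a * (mXZ (x, z) * tau (z, x) a))).
    rewrite rsum_sum => [|a]; last exact/summZ/summ_cond.
    rewrite -/mYZ /F' mulr_sumr; apply: eq_bigr => a _.
    rewrite rsumZ -?tau'E; last exact: summ_cond.
    have [z0|z0] := eqVneq (mZ z) 0; first by rewrite /c mYZ_eq0// !mul0r.
    by rewrite /c; field.
  apply: eq_rsum => x.
  have -> : indep_mass (e (y, z, x)) = mYZ (y, z) * (mXZ (x, z) / mZ z) by [].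
  by rewrite mulr_sumr; apply: eq_bigr => a _; rewrite /c; ring.
rewrite /expect -rsumB//.
apply: le_trans Hd; apply: (ler_norm_rsum (summ_norm sd)) => t.
by rewrite [X in `|X|](_ : _ = (mu t - indep_mass t) * F t) ?normrM ?ler_piMr// mulrBl.
Qed.

End Marginals.

(** * Comparing the two games *)

Section Compare.
Context {R : realType} {K : finType} {C C1 D D1 : countType}.
Variables (u : info_structure R K (C * C1) (D * D1)) (g : payoff R K).
Variable (eps : R).

Let v : info_structure R K C D :=
  push (fun t : K * (C * C1) * (D * D1) => (t.1.1, t.1.2.1, t.2.1)) u.

(** In [forget_signal] the opponent's mixed action is integrated into the payoff
f, here a function of (k, c, d) and player 2's action. *)
Lemma forget_d1 :
  eps_cond_indep (push (fun t : K * (C * C1) * (D * D1) =>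
    (t.2.2, (t.1.1, t.1.2.1), t.2.1)) u) eps ->
  forall tau : @strategy2 R K (D * D1)%type g, exists tau' : strategy2 g,
  forall sigma : strategy1 g,
  `|game_payoff u (fun s => sigma s.1) tau - game_payoff v sigma tau'| <= eps.
Proof.
move=> hd1 tau; have [tau' tau'P] := forget_signal (action2 g) tau hd1.
exists tau' => sigma.
pose f (p : K * C * D) j := \sum_i sigma p.1.2 i * g p.1.1 i j.
have f1 p j : `|f p j| <= 1 by apply: mean_norm => i; exact: pay_norm.
have := tau'P f f1.
rewrite !(@expect_push _ _ _ _ _ 1); do ?[by move=> t; exact: mean_norm].
congr (`|_ - _| <= _).
  congr expect; apply/funext => -[[k [c c1]] [d d1]] /=.
  rewrite exchange_big; apply: eq_bigr => j _.
  by rewrite mulr_sumr; apply: eq_bigr => i _; rewrite mulrCA mulrA.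
rewrite /game_payoff (@expect_push _ _ _ _ _ 1) => [|t]; last exact: mean_pay_norm.
congr expect; apply/funext => t /=; rewrite [RHS]exchange_big; apply: eq_bigr => j _.
by rewrite mulr_sumr; apply: eq_bigr => i _; rewrite mulrCA mulrA.
Qed.

Lemma forget_c1 :
  eps_cond_indep (push (fun t : K * (C * C1) * (D * D1) =>
    (t.1.2.2, (t.1.1, t.2.1), t.1.2.1)) u) eps ->
  forall sigma : @strategy1 R K (C * C1)%type g, exists sigma' : strategy1 g,
  forall tau : strategy2 g,
  `|game_payoff u sigma (fun s => tau s.1) - game_payoff v sigma' tau| <= eps.
Proof.
move=> hc1 sigma; have [sigma' sigma'P] := forget_signal (action1 g) sigma hc1.
exists sigma' => tau.
pose f (p : K * D * C) i := \sum_j tau p.1.2 j * g p.1.1 i j.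
have f1 p i : `|f p i| <= 1 by apply: mean_norm => j; exact: pay_norm.
have := sigma'P f f1.
rewrite !(@expect_push _ _ _ _ _ 1); do ?[by move=> t; exact: mean_norm].
congr (`|_ - _| <= _).
  congr expect; apply/funext => -[[k [c c1]] [d d1]] /=; apply: eq_bigr => i _.
  by rewrite mulr_sumr; apply: eq_bigr => j _; rewrite mulrA.
rewrite /game_payoff (@expect_push _ _ _ _ _ 1) => [|t]; last exact: mean_pay_norm.
congr expect; apply/funext => t /=; apply: eq_bigr => i _.
by rewrite mulr_sumr; apply: eq_bigr => j _; rewrite mulrA.
Qed.

Lemma maxmin_marg :
  eps_cond_indep (push (fun t : K * (C * C1) * (D * D1) =>
    (t.2.2, (t.1.1, t.1.2.1), t.2.1)) u) eps ->
  maxmin v g - eps <= maxmin u g.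
Proof.
move=> hd1; apply/ler_addgt0Pr => delta delta0; rewrite -lerBlDr.
have [sigma sigma_opt] := near_optimal1 v g delta0.
apply: (@maxmin_ge _ _ _ _ _ _ (fun s => sigma s.1)) => tau.
have [tau' /(_ sigma)] := forget_d1 hd1 tau.
by move: (sigma_opt tau'); rewrite ler_norml => h /andP[h1 _]; lra.
Qed.

Lemma minmax_marg :
  eps_cond_indep (push (fun t : K * (C * C1) * (D * D1) =>
    (t.1.2.2, (t.1.1, t.2.1), t.1.2.1)) u) eps ->
  minmax u g <= minmax v g + eps.
Proof.
move=> hc1; apply/ler_addgt0Pr => delta delta0.
have [tau tau_opt] := near_optimal2 v g delta0.
apply: (@minmax_le _ _ _ _ _ _ (fun s => tau s.1)) => sigma.
have [sigma' /(_ tau)] := forget_c1 hc1 sigma.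
by move: (tau_opt sigma'); rewrite ler_norml => h /andP[_ h1]; lra.
Qed.

End Compare.

Theorem proposition14 (R : realType) (K : finType) (hK : (2 <= #|K|)%N)
    (C C1 D D1 : countType) (eps : R)
    (u : info_structure R K (C * C1) (D * D1))
    (v : info_structure R K C D)
    (hv : v = push (fun t : K * (C * C1) * (D * D1) =>
                      (t.1.1, t.1.2.1, t.2.1)) u)
    (hd1 : eps_cond_indep
             (push (fun t : K * (C * C1) * (D * D1) =>
                      (t.2.2, (t.1.1, t.1.2.1), t.2.1)) u) eps)
    (hc1 : eps_cond_indep
             (push (fun t : K * (C * C1) * (D * D1) =>
                      (t.1.2.2, (t.1.1, t.2.1), t.1.2.1)) u) eps) :
  value_dist u v <= eps.
Proof.
apply: ge_sup => [|_ [g ->]].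
  pose zero (k : K) (i j : unit) : R := 0.
  have zero_bounded k i j : -1 <= zero k i j <= 1 by rewrite oppr_le0 ler01.
  have unit0 : (0 < #|{: unit}|)%N by rewrite card_unit.
  by exists `|value u (Payoff unit0 unit0 zero_bounded) -
    value v (Payoff unit0 unit0 zero_bounded)|; eexists.
have lo := maxmin_marg g hd1; have hi := minmax_marg g hc1.
rewrite -hv !minimax in lo hi.
by rewrite !value_maxmin ler_norml; apply/andP; split; lra.
Qed.
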